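(* Let $d\ge1$, let $F=\mathbb{R}^d$ with its usual distance $d_F$, and let $f:\mathfrak{S}_\infty\to\mathbb{R}^d$. Let $(\sigma_n)_{n\ge1}$ and $(\sigma_{ref,n})_{n\ge1}$ be two conjugation invariant sequences of random permutations. Suppose that $\varepsilon'_{n,\#(\sigma_{ref,n})}(f)\to 0$ in probability and $\varepsilon'_{n,\#(\sigma_{n})}(f)\to 0$ in probability as $n\to\infty$, and that there exists an $\mathbb{R}^d$-valued random variable $X$ such that $f(\sigma_{ref,n})\to X$ in distribution as $n\to\infty$. Then $f(\sigma_n)\to X$ in distribution as $n\to\infty$.
   Context: $\mathfrak{S}_n$ is the group of permutations of $\{1,\dots,n\}$, $\mathfrak{S}_\infty:=\cup_{n\ge1}\mathfrak{S}_n$, and $\#(\sigma)$ is the number of cycles of $\sigma$ (fixed points included). A sequence of random permutations $(\sigma_n)_{n\ge1}$ is conjugation invariant if, for all $n\ge1$, $\sigma_n$ takes values in $\mathfrak{S}_n$ and for every $\sigma\in\mathfrak{S}_n$, $\sigma^{-1}\sigma_n\sigma$ has the same distribution as $\sigma_n$. For $E\subset\mathfrak{S}_n$ set $\mathrm{next}(E):=\{\rho\circ(i,j):\rho\in E,\ \#(\rho\circ(i,j))=\#(\rho)-1\}\cup\{\rho\in E:\#(\rho)=1\}$, where $(i,j)$ denotes a transposition. For $\sigma\in\mathfrak{S}_n$ set $\mathrm{final}(\sigma):=\mathrm{next}^{\#(\sigma)-1}(\{\sigma\})$ if $\#(\sigma)>1$ (iterating $\mathrm{next}$ $\#(\sigma)-1$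 times) and $\mathrm{final}(\sigma):=\{\sigma\}$ otherwise. For $1\le k\le n$, $$\varepsilon'_{n,k}(f):=\max_{\sigma\in\mathfrak{S}_n,\ \#(\sigma)=k}\ \max_{\rho\in\mathrm{final}(\sigma)} d_F(f(\sigma),f(\rho)).$$ *)

(* Defs.v *)
From HB Require Import structures.
From mathcomp Require Import all_boot all_order all_algebra all_fingroup.
From mathcomp Require Import all_classical all_reals all_analysis.

Set Implicit Arguments.
Unset Strict Implicit.
Unset Printing Implicit Defensive.

Import Order.TTheory GRing.Theory Num.Theory.
Import numFieldNormedType.Exports.

Local Open Scope classical_set_scope.
Local Open Scope ring_scope.

(* The [porbits] of [s] include the singletons given by its fixed points. *)
Definition ncycles (n : nat) (s : 'S_n) : nat := #|porbits s|.

(* [s * t] in ['S_n] applies [s] first, so that [r \o (i,j)] as functions is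
   [tperm i j * r]. *)
Definition next_perms (n : nat) (E : {set 'S_n}) : {set 'S_n} :=
  ([set s : 'S_n | [exists r in E, exists i, exists j,
     [&& i != j, s == (tperm i j * r)%g & ncycles s == (ncycles r).-1]]]
   :|: [set r in E | ncycles r == 1%N])%SET.

Definition final_perms (n : nat) (s : 'S_n) : {set 'S_n} :=
  if (1 < ncycles s)%N then iter (ncycles s).-1 (@next_perms n) [set s]%SET
  else [set s]%SET.

(* The [Num.norm] of ['rV_d] is the sup norm, hence the explicit formula. *)
Definition edist (R : realType) (d : nat) (x y : 'rV[R]_d) : R :=
  Num.sqrt (\sum_(i < d) (x ord0 i - y ord0 i) ^+ 2).

(* Symmetric groups of different degrees are disjoint: a function on their
   union is a family indexed by the degree.  Distances being nonnegative,
   the initial value 0 does not affect the maxima over nonempty sets. *)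
Definition eps' (R : realType) (d : nat) (f : forall n, 'S_n -> 'rV[R]_d)
    (n k : nat) : R :=
  \big[Num.max/0]_(s : 'S_n | ncycles s == k)
    \big[Num.max/0]_(r in final_perms s) edist (f n s) (f n r).

Section discrete_measurable_perm.
Variable I : finType.

HB.instance Definition _ := isPointed.Build (perm_type I) 1%g.

Let discrete : set (set (perm_type I)) := setT.

Let discrete0 : discrete set0. Proof. by []. Qed.

Let discreteC A : discrete A -> discrete (~` A). Proof. by []. Qed.

Let discreteU (F : (set (perm_type I))^nat) :
  (forall i, discrete (F i)) -> discrete (\bigcup_i F i).
Proof. by []. Qed.

HB.instance Definition _ := @isMeasurable.Build default_measure_display
  (perm_type I) discrete discrete0 discreteC discreteU.

End discrete_measurable_perm.

Definition borel_rV (R : realType) (d : nat) :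
    measurableType (@open 'rV[R]_d).-sigma :=
  g_sigma_algebraType (@open 'rV[R]_d).

Section function_of_random_perm.
Context (dT dU : measure_display) (T : measurableType dT)
  (U : measurableType dU) (n : nat).

Definition perm_comp (h : 'S_n -> U) (s : {mfun T >-> 'S_n}) : T -> U :=
  fun w => h (s w).

Lemma measurable_perm_comp (h : 'S_n -> U) (s : {mfun T >-> 'S_n}) :
  measurable_fun [set: T] (perm_comp h s).
Proof.
move=> _ A _.
rewrite setTI (_ : _ @^-1` _ = s @^-1` (h @^-1` A)) //.
exact: measurable_funPTI.
Qed.

HB.instance Definition _ (h : 'S_n -> U) (s : {mfun T >-> 'S_n}) :=
  isMeasurableFun.Build _ _ _ _ (perm_comp h s) (measurable_perm_comp h s).

End function_of_random_perm.

(* Below, the n-th variable of a sequence lives on its own probability space;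
   only the individual laws matter. *)

(* As composed functions, [t^-1 \o s \o t] is [t * s * t^-1] in ['S_n]. *)
Definition conjugation_invariant (R : realType) (dT : nat -> measure_display)
    (T : forall n, measurableType (dT n)) (P : forall n, probability (T n) R)
    (sigma : forall n, {RV P n >-> 'S_n}) : Prop :=
  forall n : nat, (0 < n)%N -> forall t : 'S_n, forall A : set 'S_n,
    measurable A ->
    distribution (P n)
      (perm_comp (fun s : 'S_n => (t * s * t^-1)%g : 'S_n) (sigma n)) A
    = distribution (P n) (sigma n) A.

Definition cvg_in_probability (R : realType) (dT : nat -> measure_display)
    (T : forall n, measurableType (dT n)) (P : forall n, probability (T n) R)
    (Y : forall n, {RV P n >-> R}) (l : R) : Prop :=
  forall e : R, 0 < e ->
    (fun n => P n [set w | e < `|Y n w - l|]) @ \oo --> (0 : \bar R).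

Definition cvg_in_distribution (R : realType) (d : nat)
    (dT : nat -> measure_display) (T : forall n, measurableType (dT n))
    (P : forall n, probability (T n) R)
    (Y : forall n, {RV P n >-> borel_rV R d})
    (dU : measure_display) (U : measurableType dU) (Q : probability U R)
    (X : {RV Q >-> borel_rV R d}) : Prop :=
  forall g : 'rV[R]_d -> R, continuous g ->
    (exists M : R, forall x, `|g x| <= M) ->
    (fun n => 'E_(P n)[fun w => g (Y n w)])%E @ \oo -->
      'E_Q[fun w => g (X w)]%E.

(* Main.v *)
Require Import Defs.
From HB Require Import structures.
From mathcomp Require Import all_boot all_order all_algebra all_fingroup.
From mathcomp Require Import all_classical all_reals all_analysis.
From mathcomp Require Import ring lra.

Set Implicit Arguments.
Unset Strict Implicit.
Unset Printing Implicit Defensive.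

Import Order.TTheory GRing.Theory Num.Theory.
Import numFieldNormedType.Exports.

Local Open Scope classical_set_scope.
Local Open Scope ring_scope.

(** The random one-cycle permutation obtained from a conjugation invariant
    [sigma] by drawing a uniform element of [final_perms sigma] has a law that
    does not depend on [sigma].  Indeed [final_perms] commutes with conjugation,
    so this law is conjugation invariant; it is carried by the permutations with
    exactly one cycle, and these form a single conjugacy class
    ([one_cycle_conj]).  In terms of the kernel [final_mean], averaging a test
    function against [sigma] gives the same value for every conjugation
    invariant [sigma] ([mean_final_mean], [mean_final_mean_eq]).

    By definition of [eps'], [f] moves by at most [eps'] along this kernel.
    Hence [f sigma_n] and [f sigma_ref_n] are both close in probability to two
    variables with the same law, and it remains to transport convergence in
    distribution from one to the other.  The test function [g] is bounded and
    continuous but only uniformly continuous on balls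
    ([continuous_unif_on_ball]), so the mass that escapes a large ball has to be
    controlled: it is small for the limit [X] ([tail_expectation_small]), thus
    for [f sigma_ref_n] at large [n], thus, up to an event on which [eps'] is
    larger than 1, for the common law on one-cycle permutations.
    [mean_transfer] is the resulting inequality.  Everything except [X] takes
    finitely many values, so expectations are finite sums weighted by the point
    masses [perm_mass]. *)

(** * Merging the cycles of a permutation *)

Lemma porbit_conjg (I : finType) (s t : {perm I}) (x : I) :
  porbit (s ^ t)%g (t x) = [set t y | y in porbit s x]%SET.
Proof.
apply/setP => y; apply/porbitP/imsetP => [[i ->]|[z /porbitP[i ->] ->]].
  by exists ((s ^+ i)%g x); rewrite ?mem_porbit// -conjXg permJ.
by exists i; rewrite -conjXg permJ.
Qed.

Lemma ncycles_conjg (n : nat) (s t : 'S_n) : ncycles (s ^ t)%g = ncycles s.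
Proof.
rewrite /ncycles -(card_imset (porbits s) (imset_inj (@perm_inj _ t))).
apply: eq_card => B; apply/imsetP/imsetP => [[x _ ->]|[_ /imsetP[x _ ->] ->]].
  by exists (porbit s ((t^-1)%g x)); rewrite ?imset_f// -porbit_conjg permKV.
by exists (t x); rewrite ?porbit_conjg.
Qed.

(** An inclusion of the conjugate of [E] in [E'] suffices for the induction on
    the number of merges; equality then follows by conjugating back. *)
Lemma next_perms_conjg (n : nat) (E E' : {set 'S_n}) (t : 'S_n) :
    {in E, forall r, (r ^ t)%g \in E'} ->
  {in next_perms E, forall s, (s ^ t)%g \in next_perms E'}.
Proof.
move=> EE' s /setUP[]; rewrite !inE.
  move=> /exists_inP[r rE /existsP[i /existsP[j /and3P[ij /eqP -> /eqP rc]]]].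
  apply/orP; left; apply/exists_inP; exists (r ^ t)%g; first exact: EE'.
  apply/existsP; exists (t i); apply/existsP; exists (t j).
  rewrite (inj_eq perm_inj) ij conjMg tpermJ eqxx/=.
  by rewrite -tpermJ -conjMg !ncycles_conjg rc.
move=> /andP[sE s1]; apply/orP; right.
by rewrite EE'// ncycles_conjg.
Qed.

Lemma final_perms_conjg (n : nat) (s t r : 'S_n) :
  ((r ^ t)%g \in final_perms (s ^ t)%g) = (r \in final_perms s).
Proof.
have sub (s' r' u : 'S_n) :
    r' \in final_perms s' -> (r' ^ u)%g \in final_perms (s' ^ u)%g.
  rewrite /final_perms ncycles_conjg; case: ifP => [_|_]; last first.
    by rewrite !inE => /eqP ->.
  move: (ncycles s').-1 => k; elim: k r' => [|k IHk] r'.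
    by rewrite !inE => /eqP ->.
  exact: next_perms_conjg.
apply/idP/idP => [|]; last exact: sub.
by move=> /(sub _ _ t^-1)%g; rewrite !conjgK.
Qed.

(** Multiplying by a transposition across two distinct cycles merges them, so
    a permutation with several cycles always has a successor. *)
Lemma next_perms_merge (n k : nat) (E : {set 'S_n}) :
    (0 < #|E|)%N -> {in E, forall r, ncycles r = k.+2} ->
  (0 < #|next_perms E|)%N /\ {in next_perms E, forall s, ncycles s = k.+1}.
Proof.
move=> /card_gt0P[r rE] Ek; split.
  have : (1 < #|porbits r|)%N by have := Ek _ rE; rewrite /ncycles => ->.
  move=> /card_gt1P[_ [_ [/imsetP[x _ ->] /imsetP[y _ ->] xy]]].
  have xNy : x \notin porbit r y by rewrite -eq_porbit_mem.
  have x_neq_y : x != y by apply: contraNneq xy => ->.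
  apply/card_gt0P; exists (tperm x y * r)%g; rewrite !inE; apply/orP; left.
  apply/exists_inP; exists r => //.
  apply/existsP; exists x; apply/existsP; exists y.
  rewrite x_neq_y eqxx/=; have := porbits_mul_tperm r x y.
  rewrite xNy x_neq_y /ncycles/= -muln2 mul1n addn1 addn2 => -[<-].
  by rewrite eqxx.
move=> s /setUP[]; rewrite inE; last by move=> /andP[/Ek ->].
by move=> /exists_inP[r' /Ek r'k /existsP[i /existsP[j /and3P[_ _ /eqP ->]]]];
  rewrite r'k.
Qed.

Lemma final_perms_cycles (n : nat) (s : 'S_n) : (0 < n)%N ->
  (0 < #|final_perms s|)%N /\ {in final_perms s, forall r, ncycles r = 1%N}.
Proof.
move=> n_gt0; have s_gt0 : (0 < ncycles s)%N.
  by apply/card_gt0P; exists (porbit s (Ordinal n_gt0)); rewrite imset_f.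
(* Starting from [k.+1] cycles, each of the [k] steps removes exactly one. *)
rewrite /final_perms; case: (ltnP 1 (ncycles s)) => [s_gt1|s_le1]; last first.
  split; first by rewrite cards1.
  by move=> r; rewrite inE => /eqP ->; apply/eqP; rewrite eqn_leq s_le1.
have [k sk] : {k | ncycles s = k.+1} by exists (ncycles s).-1; rewrite prednK.
rewrite sk /=.
have : (0 < #|[set s]%SET|)%N by rewrite cards1.
have : {in [set s]%SET, forall r : 'S_n, ncycles r = k.+1}.
  by move=> r; rewrite inE => /eqP ->.
elim: k [set s]%SET {sk} => [//|k IHk] E Ek E0.
by rewrite iterSr; have [? ?] := next_perms_merge E0 Ek; exact: IHk.
Qed.

(** * Permutations with a single cycle *)

(** Listing the points in the order in which [c] visits them conjugates [c] to
    the cyclic shift of the indices, so any two such permutations are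
    conjugate. *)
Lemma one_cycle_shift (n : nat) (c : 'S_n.+1) : ncycles c = 1%N ->
  exists t : 'S_n.+1, (perm (@ordS_inj n.+1) ^ t)%g = c.
Proof.
move=> /eqP /cards1P[B porbits_c].
have orbit x y : x \in porbit c y.
  have : porbit c x \in porbits c by rewrite imset_f.
  have : porbit c y \in porbits c by rewrite imset_f.
  by rewrite porbits_c !inE => /eqP -> /eqP <-; rewrite porbit_id.
have card_orbit : #|porbit c ord0| = n.+1.
  by rewrite -[RHS]card_ord; apply: eq_card => x; rewrite orbit.
have iterE i : (i < n.+1)%N -> nth ord0 (traject c ord0 n.+1) i = (c ^+ i)%g ord0.
  by move=> i_lt; rewrite nth_traject// permX.
have visit_inj : injective (fun i : 'I_n.+1 => (c ^+ i)%g ord0).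
  move=> i j /=; rewrite -!iterE//.
  move=> /eqP; rewrite nth_uniq ?size_traject//; first by move=> /eqP/val_inj.
  by have := uniq_traject_porbit c ord0; rewrite card_orbit.
exists (perm visit_inj); apply/permP => y.
rewrite -[y](permKV (perm visit_inj)).
move: (((perm visit_inj)^-1)%g y) => i; rewrite permJ !permE /=.
(* The shift wraps around only at the last index, where [c ^+ n.+1] fixes the
   starting point because its orbit has [n.+1] elements. *)
have [i_lt|] := ltnP i.+1 n.+1; first by rewrite modn_small// expgSr permM.
move=> i_ge; have i_max : (i : nat) = n.
  by apply: anti_leq; rewrite -ltnS ltn_ord; exact: i_ge.
rewrite -permM -expgSr i_max modnn expg0 perm1 permX.
by have := iter_porbit c ord0; rewrite card_orbit => ->.
Qed.

Lemma one_cycle_conj (n : nat) (c c' : 'S_n) : ncycles c = 1%N ->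
  ncycles c' = 1%N -> exists t : 'S_n, (c ^ t)%g = c'.
Proof.
case: n c c' => [|n] c c' c1 c'1; first by exists 1%g; apply/permP => -[].
have [[t <-] [t' <-]] := (one_cycle_shift c1, one_cycle_shift c'1).
by exists (t^-1 * t')%g; rewrite conjgM conjgK.
Qed.

(** * The uniform merging kernel *)

(** Value at [s] of the Markov operator of the kernel that sends [s] to the
    uniform law on [final_perms s]. *)
Definition final_mean (R : realType) (n : nat) (h : 'S_n -> R) (s : 'S_n) : R :=
  (\sum_(r in final_perms s) h r) / #|final_perms s|%:R.

Section final_mean.
Variables (R : realType) (n : nat).
Hypothesis n_gt0 : (0 < n)%N.
Implicit Types (h b : 'S_n -> R) (s t : 'S_n).

Let card_final_neq0 s : #|final_perms s|%:R != 0 :> R.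
Proof. by rewrite pnatr_eq0 -lt0n; case: (final_perms_cycles s n_gt0). Qed.

Lemma final_mean_conjg h s t :
  final_mean h (s ^ t)%g = final_mean (fun r => h (r ^ t)%g) s.
Proof.
rewrite /final_mean (reindex_inj (@conjg_inj _ t)).
rewrite (eq_bigl (mem (final_perms s))); last first.
  by move=> r; exact: final_perms_conjg.
congr (_ / _%:R); rewrite -(card_imset (mem (final_perms s)) (@conjg_inj _ t)).
apply: eq_card => r; apply/idP/imsetP => [rs|[r' r's ->]].
  by exists (r ^ t^-1)%g; rewrite ?conjgKV// -(final_perms_conjg _ t) conjgKV.
by rewrite final_perms_conjg.
Qed.

Lemma final_mean_le h b s : {in final_perms s, forall r, h r <= b r} ->
  final_mean h s <= final_mean b s.
Proof. by move=> hb; rewrite ler_pM2r ?ler_sum// invr_gt0 lt0r card_final_neq0/=. Qed.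

Lemma final_mean_sum (I : finType) (h : I -> 'S_n -> R) s :
  final_mean (fun r => \sum_i h i r) s = \sum_i final_mean (h i) s.
Proof. by rewrite /final_mean exchange_big/= mulr_suml. Qed.

Lemma final_mean_cst h s (a : R) : {in final_perms s, forall r, h r = a} ->
  final_mean h s = a.
Proof.
move=> ha; rewrite /final_mean (eq_bigr (fun=> a))//.
by rewrite sumr_const -[_ *+ _ in LHS]mulr_natr mulfK //; exact: card_final_neq0.
Qed.

Lemma final_mean_affine b s (a c : R) :
  final_mean (fun r => a + c * b r) s = a + c * final_mean b s.
Proof.
rewrite /final_mean big_split/= -mulr_sumr mulrDl mulrA; congr (_ + _).
by rewrite sumr_const -[_ *+ _ in LHS]mulr_natr mulfK //; exact: card_final_neq0.
Qed.

Lemma final_mean_dist h b s (a c : R) :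
    {in final_perms s, forall r, `|h s - h r| <= a + c * b r} ->
  `|h s - final_mean h s| <= a + c * final_mean b s.
Proof.
move=> hb; rewrite -final_mean_affine.
have -> : h s - final_mean h s =
    (\sum_(r in final_perms s) (h s - h r)) / #|final_perms s|%:R.
  rewrite sumrB mulrBl; congr (_ - _).
  by rewrite sumr_const -[_ *+ _ in RHS]mulr_natr mulfK //; exact: card_final_neq0.
rewrite normrM [`|_^-1|]ger0_norm ?invr_ge0//.
apply: le_trans (final_mean_le hb).
by rewrite ler_pM2r ?ler_norm_sum// invr_gt0 lt0r card_final_neq0/=.
Qed.

Section conjugation_invariant_weights.
Variable p : 'S_n -> R.
Hypothesis p_sum1 : \sum_s p s = 1.
Hypothesis p_conjg : forall s t, p (s ^ t)%g = p s.

(** Replacing [h] by its average over a conjugacy class does not change the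
    mean, and this average is constant on the permutations with one cycle,
    which form a single class and carry the kernel. *)
Lemma mean_final_mean h c : ncycles c = 1%N ->
  \sum_s p s * final_mean h s = (\sum_t h (c ^ t)%g) / #|'S_n|%:R.
Proof.
move=> c1; have Sn_neq0 : #|'S_n|%:R != 0 :> R.
  by rewrite pnatr_eq0 -lt0n; apply/card_gt0P; exists 1%g.
apply: (mulIf Sn_neq0); rewrite mulfVK//.
have -> : (\sum_s p s * final_mean h s) * #|'S_n|%:R =
    \sum_t \sum_s p s * final_mean (fun r => h (r ^ t)%g) s.
  rewrite mulr_natr -sumr_const; apply: eq_bigr => t _.
  rewrite (reindex_inj (@conjg_inj _ t)).
  by apply: eq_bigr => s _; rewrite p_conjg final_mean_conjg.
rewrite exchange_big/= -[RHS]mul1r -p_sum1 mulr_suml; apply: eq_bigr => s _.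
rewrite -mulr_sumr -final_mean_sum; congr (_ * _).
apply: final_mean_cst => r rs.
have r1 : ncycles r = 1%N by have [_] := final_perms_cycles s n_gt0; exact.
have [u <-] := one_cycle_conj c1 r1.
rewrite [RHS](reindex_inj (mulgI u)).
by apply: eq_bigr => t _; rewrite conjgM.
Qed.

End conjugation_invariant_weights.

Lemma mean_final_mean_eq (p p' : 'S_n -> R) h :
    \sum_s p s = 1 -> (forall s t, p (s ^ t)%g = p s) ->
    \sum_s p' s = 1 -> (forall s t, p' (s ^ t)%g = p' s) ->
  \sum_s p s * final_mean h s = \sum_s p' s * final_mean h s.
Proof.
move=> p1 pJ p'1 p'J; have [/card_gt0P[c c_final] c1] := final_perms_cycles 1%g n_gt0.
by rewrite (mean_final_mean p1 pJ _ (c1 _ c_final))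
           (mean_final_mean p'1 p'J _ (c1 _ c_final)).
Qed.

End final_mean.

Section mean_transfer.
Variables (R : realType) (V : normedModType R) (n : nat).
Hypothesis n_gt0 : (0 < n)%N.
Variables (f : 'S_n -> V) (e : 'S_n -> R).
Hypothesis f_final : forall s, {in final_perms s, forall r, `|f s - f r| <= e s}.
Variables (g : V -> R) (M eps delta rho : R).
Hypothesis g_le : forall x, `|g x| <= M.
Hypothesis eps_ge0 : 0 <= eps.
Hypothesis g_unif : forall x y, `|y| <= rho + 1 -> `|x - y| <= delta ->
  `|g x - g y| <= eps.

Let M_ge0 : 0 <= M. Proof. exact: le_trans (normr_ge0 _) (g_le 0). Qed.

Let far (s : 'S_n) : R := (rho + 1 < `|f s|)%R%:R.

(** Along the kernel, [g] moves by at most [eps], except when the displacement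
    exceeds [delta] or when the endpoint leaves the ball where the modulus of
    continuity is valid; there the trivial bound [2 * M] applies. *)
Lemma mean_final_mean_dist (p : 'S_n -> R) :
    (forall s, 0 <= p s) -> \sum_s p s = 1 ->
  `|\sum_s p s * g (f s) - \sum_s p s * final_mean (g \o f) s| <=
    eps + 2 * M * (\sum_s p s * (delta < e s)%R%:R)
        + 2 * M * (\sum_s p s * final_mean far s).
Proof.
move=> p_ge0 p1; rewrite -sumrB -[eps in leRHS]mul1r -[X in X * eps]p1.
rewrite mulr_suml !mulr_sumr -!big_split/=.
apply: le_trans (ler_norm_sum _ _ _) _; apply: ler_sum => s _.
rewrite -mulrBr normrM ger0_norm//.
rewrite ![2 * M * (p s * _)]mulrCA -!mulrDr ler_wpM2l//.
apply: final_mean_dist => // r rs; rewrite /far.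
have two_M : `|g (f s) - g (f r)| <= 2 * M.
  by rewrite mulrC mulr_natr mulr2n (le_trans (ler_normB _ _))// lerD.
have M2_ge0 : 0 <= 2 * M by rewrite mulr_ge0.
case: (ltP delta (e s)) => [_|es]; case: (ltP (rho + 1) `|f r|) => [_|fr];
  rewrite ?mulr1 ?mulr0 ?addr0.
- by rewrite (le_trans two_M)// -addrA ler_wpDl// lerDl.
- by rewrite (le_trans two_M)// ler_wpDl.
- by rewrite (le_trans two_M)// ler_wpDl.
- by apply: g_unif => //; rewrite (le_trans (f_final rs)).
Qed.

(** The kernel gives the same law from [p] and from [p'], so the far mass of this
    law is controlled by [p'] alone: a far [f r] forces [f s] to be far as well,
    unless the displacement exceeds 1. *)
Lemma mean_transfer (p p' : 'S_n -> R) (phi : V -> R) :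
    (forall s, 0 <= p s) -> \sum_s p s = 1 -> (forall s t, p (s ^ t)%g = p s) ->
    (forall s, 0 <= p' s) -> \sum_s p' s = 1 ->
    (forall s t, p' (s ^ t)%g = p' s) ->
    (forall x, 0 <= phi x) -> (forall x, rho < `|x| -> 1 <= phi x) ->
  `|\sum_s p s * g (f s) - \sum_s p' s * g (f s)| <=
    2 * eps + 2 * M * (\sum_s p s * (delta < e s)%R%:R
                     + \sum_s p' s * (delta < e s)%R%:R)
      + 4 * M * (\sum_s p' s * phi (f s) + \sum_s p' s * (1 < e s)%R%:R).
Proof.
move=> p_ge0 p1 pJ p'_ge0 p'1 p'J phi_ge0 phi_ge1.
have far_le : \sum_s p' s * final_mean far s <=
    \sum_s p' s * phi (f s) + \sum_s p' s * (1 < e s)%R%:R.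
  rewrite -big_split/=; apply: ler_sum => s _; rewrite -mulrDr ler_wpM2l//.
  rewrite -[leRHS](@final_mean_cst _ _ n_gt0 (fun=> phi (f s) + (1 < e s)%R%:R) s)//.
  apply: final_mean_le => // r rs; rewrite /far.
  case: ltP => [fr|_]; last by rewrite addr_ge0.
  case: (ltP 1 (e s)) => [_|es]; first by rewrite lerDr.
  rewrite addr0 phi_ge1// -(ltrD2r 1) (lt_le_trans fr)//.
  have -> : f r = f s - (f s - f r) by rewrite subKr.
  rewrite (le_trans (ler_normB _ _))// lerD2l.
  exact: le_trans (f_final rs) es.
have := mean_final_mean_dist p_ge0 p1; have := mean_final_mean_dist p'_ge0 p'1.
rewrite !(mean_final_mean_eq n_gt0 _ p1 pJ p'1 p'J).
set a := \sum_s p' s * g (f s); set b := \sum_s p s * g (f s).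
set m := \sum_s p' s * final_mean (g \o f) s.
move: far_le; set q := \sum_s p' s * final_mean far s.
set z := \sum_s _ + \sum_s _ => qz.
have {qz} qz : 2 * M * q <= 2 * M * z by rewrite ler_wpM2l// mulr_ge0.
rewrite mulrDr => am bm.
have -> : b - a = (b - m) - (a - m) by rewrite opprB addrA subrK.
apply: le_trans (ler_normB _ _) _; lra.
Qed.

End mean_transfer.

(** * Laws of random permutations *)

Section law.
Context (R : realType) (d : measure_display) (T : measurableType d)
  (P : probability T R) (n : nat) (sigma : {RV P >-> 'S_n}).

Definition perm_mass (s : 'S_n) : R := fine (P (sigma @^-1` [set s])).

Let measurable_fiber (s : 'S_n) : measurable (sigma @^-1` [set s]).
Proof. exact: measurable_funPTI. Qed.

Lemma perm_massE s : (perm_mass s)%:E = P (sigma @^-1` [set s]).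
Proof. by rewrite fineK// fin_num_measure. Qed.

Lemma perm_mass_ge0 s : 0 <= perm_mass s.
Proof. by rewrite fine_ge0. Qed.

Lemma expectation_perm (h : 'S_n -> R) :
  'E_P[fun w => h (sigma w)]%E = (\sum_s perm_mass s * h s)%:E.
Proof.
rewrite unlock.
transitivity (\int[P]_w (\sum_s (h s)%:E * (\1_(sigma @^-1` [set s]) w)%:E))%E.
  apply: eq_integral => w _; rewrite (bigD1 (sigma w))//= big1 ?adde0.
    by rewrite indicE mem_set// mule1.
  by move=> s /eqP s_neq; rewrite indicE memNset ?mule0// => /= /esym.
rewrite integral_sum//; last first.
  by move=> s; apply: integrableZl => //; exact: integrable_indic.
rewrite -sumEFin; apply: eq_bigr => s _.
rewrite integralZl//; last exact: integrable_indic.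
by rewrite integral_indic// setIT EFinM perm_massE muleC.
Qed.

Lemma probability_perm (A : pred 'S_n) :
  P [set w | A (sigma w)] = (\sum_s perm_mass s * (A s)%:R)%:E.
Proof.
have mA : measurable [set w | A (sigma w)].
  by rewrite (_ : mkset _ = sigma @^-1` [set s | A s]); first exact: measurable_funPTI.
rewrite -expectation_indic// -expectation_perm; congr ('E_P[_])%E.
by apply/funext => w; rewrite indicE mem_setE.
Qed.

Lemma perm_mass_sum : \sum_s perm_mass s = 1.
Proof.
apply: EFin_inj; rewrite -(@probability_setT _ _ _ P).
rewrite (_ : setT = [set w | predT (sigma w)]); last by apply/seteqP; split.
by rewrite probability_perm; congr EFin; apply: eq_bigr => s _; rewrite mulr1.
Qed.

End law.

Lemma perm_mass_conjg (R : realType) (dT : nat -> measure_display)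
    (T : forall n, measurableType (dT n)) (P : forall n, probability (T n) R)
    (sigma : forall n, {RV P n >-> 'S_n}) (n : nat) (s t : 'S_n) :
    conjugation_invariant sigma -> (0 < n)%N ->
  perm_mass (sigma n) (s ^ t)%g = perm_mass (sigma n) s.
Proof.
move=> sigmaJ n_gt0; have := sigmaJ n n_gt0 t [set s] I.
rewrite /distribution /pushforward /= => /(congr1 fine).
rewrite -/(perm_mass (sigma n) s) => <-; congr (fine (P n _)).
apply/seteqP; split => w /=; rewrite /perm_comp conjgE.
  by move=> ->; rewrite !mulgA mulgV mul1g mulgK.
by move=> <-; rewrite !mulgA mulVg mul1g mulgKV.
Qed.

(** * Continuous functions and tightness in Euclidean space *)

Section euclidean.
Variables (R : realType) (d : nat).

(** The norm of row vectors is the maximum norm, so it is dominated by the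
    Euclidean distance that defines [eps']. *)
Lemma norm_le_edist (x y : 'rV[R]_d) : `|x - y| <= Defs.edist x y.
Proof.
rewrite [leLHS]/Num.Def.normr/= mx_normrE; apply/bigmax_leP; split=> [|[i j] _ /=].
  exact: sqrtr_ge0.
rewrite ord1 -sqrtr_sqr !mxE ler_sqrt ?sumr_ge0//; last by move=> k _; exact: sqr_ge0.
by rewrite (bigD1 j)//= lerDl sumr_ge0// => k _; exact: sqr_ge0.
Qed.

Lemma final_dist_le_eps' (f : forall n, 'S_n -> 'rV[R]_d) (n : nat) (s : 'S_n) :
  {in final_perms s, forall r, `|f n s - f n r| <= eps' f n (ncycles s)}.
Proof.
move=> r rs; apply: le_trans (norm_le_edist _ _) _; rewrite /eps'.
apply: (bigmax_sup s) => //.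
exact: (le_bigmax_cond _ (fun r => Defs.edist (f n s) (f n r))).
Qed.

Lemma continuous_unif_on_ball (g : 'rV[R]_d -> R) (rho eps : R) :
    continuous g -> 0 < eps ->
  exists2 delta : R, 0 < delta & forall x y : 'rV[R]_d,
    `|y| <= rho -> `|x - y| <= delta -> `|g x - g y| <= eps.
Proof.
move=> g_cont eps_gt0.
have : compact [set y : 'rV[R]_d | `|y| <= rho].
  apply: bounded_closed_compact.
    exists rho; split; first exact: num_real.
    by move=> M rhoM y /= /le_trans; apply; exact: ltW.
  rewrite (_ : mkset _ = Num.norm @^-1` [set z | z <= rho]) //.
  apply: closed_comp; last exact: closed_le.
  by move=> y _; exact: norm_continuous.
move=> /compact_near_coveringP/(_ R 0^'+ (fun delta y => forall x : 'rV[R]_d,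
  `|x - y| <= delta -> `|g x - g y| <= eps)) cover.
have : \forall delta \near 0^'+, [set y : 'rV[R]_d | `|y| <= rho] `<=`
   (fun y => forall x : 'rV[R]_d, `|x - y| <= delta -> `|g x - g y| <= eps).
  apply: cover => y0 _.
  have eps2_gt0 : 0 < eps / 2 by rewrite divr_gt0.
  have [eta eta_gt0 eta_g] : exists2 eta : R, 0 < eta &
      forall y : 'rV[R]_d, `|(y0 : 'rV[R]_d) - y| < eta -> `|g y0 - g y| < eps / 2.
    have /cvgrPdist_lt/(_ _ eps2_gt0) near_y0 := g_cont y0.
    exact: (iffLR (@nbhs_normP R 'rV[R]_d _ _) near_y0).
  exists ([set y : 'rV[R]_d | `|(y0 : 'rV[R]_d) - y| < eta / 2], [set delta | delta < eta / 2]).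
    split => /=.
      by apply: (iffRL (@nbhs_normP R 'rV[R]_d _ _)); exists (eta / 2) => //=; rewrite divr_gt0.
    by apply: nbhs_right_lt; rewrite divr_gt0.
  move=> [y delta] /= [y0y delta_eta] x xy.
  have gy : `|g y0 - g y| < eps / 2.
    by apply: eta_g => /=; rewrite (lt_trans y0y)// ltr_pdivrMr// ltr_pMr// ltrDl.
  have gx : `|g y0 - g x| < eps / 2.
    apply: eta_g => /=; rewrite -(subrKA y) [eta]splitr.
    by rewrite (le_lt_trans (ler_normD _ _))// ltrD// distrC (le_lt_trans xy).
  rewrite distrC -(subrKA (g y0)) [eps]splitr.
  by rewrite (le_trans (ler_normD _ _))// lerD// ltW// distrC.
move=> near_unif; near (0 : R)^'+ => delta; exists delta => // x y yrho.
by apply: (near near_unif delta _ y yrho).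
Unshelve. all: by end_near. Qed.

(** A continuous majorant of the indicator of the complement of the ball of
    radius [rho + 1]. *)
Definition tail (rho : R) (x : 'rV[R]_d) : R := Num.min 1 (Num.max 0 (`|x| - rho)).

Lemma tail_ge0 rho x : 0 <= tail rho x.
Proof. by rewrite /tail le_min ler01 le_max lexx. Qed.

Lemma tail_le1 rho x : tail rho x <= 1.
Proof. by rewrite /tail ge_min lexx. Qed.

Lemma tail_eq0 rho x : `|x| <= rho -> tail rho x = 0.
Proof. by rewrite -subr_le0 => x_le; rewrite /tail max_l// min_r. Qed.

Lemma tail_ge1 rho x : rho + 1 < `|x| -> 1 <= tail rho x.
Proof. by move=> x_gt; rewrite /tail le_min lexx le_max; apply/orP; right; lra. Qed.

Lemma continuous_tail rho : continuous (tail rho).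
Proof.
move=> x.
have -> : tail rho = cst 1 \min (cst 0 \max (fun y : 'rV[R]_d => `|y| - rho)) by [].
apply: continuous_min; first exact: cst_continuous.
apply: continuous_max; first exact: cst_continuous.
apply: (@cvgB R R^o); [exact: nbhs_filter|exact: (@norm_continuous R 'rV[R]_d)|exact: cst_continuous].
Qed.

Section tightness.
Context (dU : measure_display) (U : measurableType dU) (Q : probability U R).
Variable X : {RV Q >-> borel_rV R d}.

Lemma measurable_continuous_RV (g : 'rV[R]_d -> R) : continuous g ->
  measurable_fun [set: U] (fun w => g (X w)).
Proof.
move=> /continuousP g_open.
apply: (measurability _ (measurable_realfun.RGenOpens.measurableE R)) => _ [_ [a [b ->]] <-].
rewrite setTI (_ : _ @^-1` _ = X @^-1` (g @^-1` `]a, b[))//.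
apply: measurable_funPTI; apply: sub_sigma_algebra; apply: g_open.
exact: interval_open.
Qed.

Lemma tail_expectation_small (eps : R) : 0 < eps ->
  exists rho : R, ('E_Q[fun w => tail rho (X w)] < eps%:E)%E.
Proof.
move=> eps_gt0.
(* The events [F k] decrease to the empty set and dominate [tail k]. *)
pose F (k : nat) := [set w | k%:R < `|X w : 'rV[R]_d|].
have mF k : measurable (F k).
  rewrite -[F k]setTI.
  have mX : measurable_fun [set: U] (fun w => `|X w : 'rV[R]_d|).
    exact: (measurable_continuous_RV (@norm_continuous _ _)).
  rewrite (_ : F k = (fun w => `|X w : 'rV[R]_d|) @^-1` `]k%:R, +oo[).
    exact: mX.
  by apply/seteqP; split => w /=; rewrite in_itv/= andbT.
have F0 : \bigcap_k F k = set0.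
  rewrite -subset0 => w /(_ (Num.truncn `|X w : 'rV[R]_d|).+1 I); rewrite /F/=.
  by rewrite ltNge ltW ?truncnS_gt.
have : Q \o F @ \oo --> 0%E.
  rewrite -(measure0 Q) -F0; apply: nonincreasing_cvg_mu => //.
  - by rewrite (le_lt_trans (probability_le1 _ _))// ltry.
  - by rewrite F0.
  - move=> k l kl; apply/subsetPset => w /=; apply: le_lt_trans.
    by rewrite ler_nat.
move=> /(_ [set x : \bar R | (x < eps%:E)%E]) QF.
have {QF} [k _ /(_ k (leqnn k)) /= Qk] : \forall k \near \oo, (Q (F k) < eps%:E)%E.
  by apply: QF; apply: open_nbhs_nbhs; split; [exact: open_ereal_lt_ereal|rewrite /= lte_fin].
exists k%:R; apply: le_lt_trans Qk; rewrite -expectation_indic//.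
apply: expectation_le => //.
- by apply: measurable_continuous_RV; exact: continuous_tail.
- by move=> w; exact: tail_ge0.
apply: aeW => w; rewrite indicE; case: (boolP (w \in F k)) => [_|].
  exact: tail_le1.
by rewrite notin_setE /F/= => /negP; rewrite -leNgt => /tail_eq0 ->.
Qed.
End tightness.
End euclidean.

(** * Convergence in distribution *)

Lemma eps'_ge0 (R : realType) (d : nat) (f : forall n, 'S_n -> 'rV[R]_d) (n k : nat) :
  0 <= eps' f n k.
Proof. exact: bigmax_ge_id. Qed.

Lemma eps'_mass_small (R : realType) (d : nat) (f : forall n, 'S_n -> 'rV[R]_d)
    (dT : nat -> measure_display) (T : forall n, measurableType (dT n))
    (P : forall n, probability (T n) R) (sigma : forall n, {RV P n >-> 'S_n})
    (delta eps : R) :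
    cvg_in_probability
      (fun n => perm_comp (fun s : 'S_n => eps' f n (ncycles s)) (sigma n) :
         {RV (P n) >-> R}) 0 ->
    0 < delta -> 0 < eps ->
  \forall n \near \oo,
    \sum_s perm_mass (sigma n) s * (delta < eps' f n (ncycles s))%R%:R < eps.
Proof.
move=> cvgP delta_gt0 eps_gt0.
have lt_nbhs : nbhs (0 : \bar R)%E [set x : \bar R | (x < eps%:E)%E].
  by apply: open_nbhs_nbhs; split; [exact: open_ereal_lt_ereal|rewrite /= lte_fin].
have : \forall n \near \oo, (P n [set w |
    (delta < `|perm_comp (fun s => eps' f n (ncycles s)) (sigma n) w - 0|)%R] < eps%:E)%E.
  exact: cvgP delta delta_gt0 _ lt_nbhs.
apply: filterS => n.
rewrite -lte_fin -probability_perm; congr (P n _ < _)%E.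
by apply/seteqP; split => w /=; rewrite /perm_comp subr0 ger0_norm// eps'_ge0.
Qed.

Lemma expectation_mass_small (R : realType) (d : nat) (f : forall n, 'S_n -> 'rV[R]_d)
    (dT : nat -> measure_display) (T : forall n, measurableType (dT n))
    (P : forall n, probability (T n) R) (sigma : forall n, {RV P n >-> 'S_n})
    (dU : measure_display) (U : measurableType dU) (Q : probability U R)
    (X : {RV Q >-> borel_rV R d}) (g : 'rV[R]_d -> R) (eps : R) :
    cvg_in_distribution
      (fun n => perm_comp (f n : 'S_n -> borel_rV R d) (sigma n) :
         {RV (P n) >-> borel_rV R d}) X ->
    continuous g -> (exists M : R, forall x, `|g x| <= M) ->
    ('E_Q[fun w => g (X w)] < eps%:E)%E ->
  \forall n \near \oo, \sum_s perm_mass (sigma n) s * g (f n s) < eps.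
Proof.
move=> cvgD g_cont g_bound EX.
have lt_nbhs : nbhs 'E_Q[fun w => g (X w)]%E [set x : \bar R | (x < eps%:E)%E].
  by apply: open_nbhs_nbhs; split; [exact: open_ereal_lt_ereal|].
have : \forall n \near \oo,
    ('E_(P n)[fun w => g (f n (sigma n w))] < eps%:E)%E.
  exact: cvgD g g_cont g_bound _ lt_nbhs.
apply: filterS => n.
by rewrite (expectation_perm (sigma n) (g \o f n)) lte_fin.
Qed.

Theorem theorem2 (R : realType) (d : nat) (hd : (0 < d)%N)
    (f : forall n : nat, 'S_n -> 'rV[R]_d)
    (dT : nat -> measure_display) (T : forall n : nat, measurableType (dT n))
    (P : forall n : nat, probability (T n) R)
    (sigma : forall n : nat, {RV (P n) >-> 'S_n})
    (dT' : nat -> measure_display) (T' : forall n : nat, measurableType (dT' n))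
    (P' : forall n : nat, probability (T' n) R)
    (sigma_ref : forall n : nat, {RV (P' n) >-> 'S_n})
    (dU : measure_display) (U : measurableType dU) (Q : probability U R)
    (X : {RV Q >-> borel_rV R d}) :
  conjugation_invariant sigma ->
  conjugation_invariant sigma_ref ->
  cvg_in_probability
    (fun n => perm_comp (fun s : 'S_n => eps' f n (ncycles s)) (sigma_ref n) :
       {RV (P' n) >-> R}) 0 ->
  cvg_in_probability
    (fun n => perm_comp (fun s : 'S_n => eps' f n (ncycles s)) (sigma n) :
       {RV (P n) >-> R}) 0 ->
  cvg_in_distribution
    (fun n => perm_comp (f n : 'S_n -> borel_rV R d) (sigma_ref n) :
       {RV (P' n) >-> borel_rV R d}) X ->
  cvg_in_distribution
    (fun n => perm_comp (f n : 'S_n -> borel_rV R d) (sigma n) :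
       {RV (P n) >-> borel_rV R d}) X.
Proof.
move=> sigmaJ refJ eps_ref eps_sigma cvg_ref g g_cont [M g_le].
have M_ge0 : 0 <= M by exact: le_trans (normr_ge0 _) (g_le 0).
pose a n := \sum_s perm_mass (sigma n) s * g (f n s).
pose a' n := \sum_s perm_mass (sigma_ref n) s * g (f n s).
suff a_cvg : (fun n => a n - a' n) @ \oo --> 0.
  have -> : (fun n => 'E_(P n)[fun w => g (f n (sigma n w))])%E =
      (fun n => 'E_(P' n)[fun w => g (f n (sigma_ref n w))]
                + (a n - a' n)%:E)%E.
    apply/funext => n; rewrite (expectation_perm (sigma n) (g \o f n)).
    rewrite (expectation_perm (sigma_ref n) (g \o f n)) -EFinD.
    by rewrite /a /a' addrC subrK.
  rewrite -['E_Q[_]%E]adde0; apply: cvgeD.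
  - by rewrite fin_num_adde_defl.
  - by apply: cvg_ref => //; exists M.
  - by apply: cvg_EFin; [exact: nearW|].
apply/cvgrPdist_le => eta eta_gt0.
(* With every small quantity of [mean_transfer] below [eps], its bound is
   [2 * eps + 4 * M * eps + 8 * M * eps]. *)
have C_gt0 : 0 < 2 + 12 * M by rewrite ltr_wpDr// mulr_ge0.
pose eps := eta / (2 + 12 * M).
have eps_gt0 : 0 < eps by rewrite divr_gt0.
have [rho X_tail] := tail_expectation_small X eps_gt0.
(* [tail rho] reaches 1 at radius [rho + 1], and the displacement on the good
   event adds at most 1. *)
have [delta delta_gt0 g_unif] :=
  continuous_unif_on_ball (rho + 1 + 1) g_cont eps_gt0.
have tail_bound : exists M : R, forall x : 'rV[R]_d, `|tail rho x| <= M.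
  by exists 1 => x; rewrite ger0_norm ?tail_ge0 ?tail_le1.
have near_sigma := eps'_mass_small eps_sigma delta_gt0 eps_gt0.
have near_ref := eps'_mass_small eps_ref delta_gt0 eps_gt0.
have near_ref1 := eps'_mass_small eps_ref ltr01 eps_gt0.
have near_tail :=
  expectation_mass_small cvg_ref (@continuous_tail R d rho) tail_bound X_tail.
near=> n; have n_gt0 : (0 < n)%N by near: n; exact: nbhs_infty_gt.
rewrite sub0r normrN.
have := mean_transfer n_gt0 (@final_dist_le_eps' R d f n) g_le (ltW eps_gt0) g_unif
  (@perm_mass_ge0 _ _ _ _ _ (sigma n)) (perm_mass_sum (sigma n))
  (fun s t => perm_mass_conjg s t sigmaJ n_gt0)
  (@perm_mass_ge0 _ _ _ _ _ (sigma_ref n)) (perm_mass_sum (sigma_ref n))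
  (fun s t => perm_mass_conjg s t refJ n_gt0)
  (@tail_ge0 R d rho) (@tail_ge1 R d rho).
move=> /le_trans; apply.
have -> : eta = 2 * eps + 2 * M * (eps + eps) + 4 * M * (eps + eps).
  by rewrite /eps; field; rewrite gt_eqF.
apply: lerD; [apply: lerD => //|]; apply: ler_wpM2l; rewrite ?mulr_ge0//;
  apply: lerD; apply: ltW; near: n.
- exact: near_sigma.
- exact: near_ref.
- exact: near_tail.
- exact: near_ref1.
Unshelve. all: by end_near. Qed.
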